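(* Let $d\in\mathbb{N}_{+}$, $s\in\mathbb{N}$ with $d\geq 2s+15$, and $\delta>0$. There are constants $p_{0}$, $c>0$, $C$ depending only on $\delta,d$ such that for every prime $p\ge p_{0}$, every non-degenerate quadratic form $M\colon\mathbb{F}_{p}^{d}\to\mathbb{F}_{p}$, every $H\subseteq\mathbb{F}_{p}^{d}$ and every map $\xi\colon H\to\mathrm{HP}_{d}(s)$ whose $M$-energy is at least $\delta p^{3d}$, there exists $H'\subseteq H$ with $|H'|\geq c\,p^{d}$ such that ${\#}_{\mathrm{dd}}(\tilde{\xi}(H')\hat{+}\tilde{\xi}(H'))\leq C$, where $\tilde\xi(h):=(h,J^{M}_{h}+\xi(h))$.
   Context: $\mathrm{HP}_{d}(s)$: homogeneous degree-$s$ polynomials in $\mathbb{F}_{p}[x_{1},\dots,x_{d}]$ plus $0$. Quadratic form $M(n)=(nA)\cdot n+n\cdot u+v$, $A$ symmetric, non-degenerate if $\det A\neq0$. For a subspace $V\subseteq\mathbb{F}_{p}^{d}$, $J^{M}_{V}$ is the ideal of $\mathbb{F}_{p}[x_{1},\dots,x_{d}]$ generated by $n\mapsto(nA)\cdot n$ and $n\mapsto(hA)\cdot n$, $h\in V$; $J^{M}_{h_{1},\dots,h_{k}}:=J^{M}_{\mathrm{span}\{h_{1},\dots,h_{k}\}}$. The $M$-energy of $\xi$ is the number of $(h_{1},h_{2},h_{3},h_{4})\in H^{4}$ with $h_{1}-h_{2}=h_{3}-h_{4}$ and $\xi(h_{1})-\xi(h_{2})-\xi(h_{3})+\xi(h_{4})\in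 J^{M}_{h_{1},h_{2},h_{3},h_{4}}$. $\Gamma^{s}(M)$ is the set of pairs $(h,J^{M}_{V}+f)$ with $V$ a subspace of $\mathbb{F}_{p}^{d}$, $h\in V$, $f\in\mathrm{HP}_{d}(s)$; $\pi(h,J^M_V+f)=h$. Write $(h,I+f)\sim(h',I'+f')$ iff $h=h'$ and $f-f'\in I+I'$. For $X,Y\subseteq\Gamma^{s}(M)$, $X\hat{+}Y=\{(h+h',I+I'+f+f')\colon (h,I+f)\in X,(h',I'+f')\in Y\}$. For $X\subseteq\Gamma^{s}(M)$ with $\pi(X)=\{h\}$, an auxiliary graph is a bipartite graph $(X,Y,E')$ with $Y$ finite such that whenever $x\neq x'$ in $X$ and $y\in Y$ with $(x,y),(x',y)\in E'$ we have $x\sim x'$; it is $\epsilon$-dense if every $x\in X$ has at least $\epsilon|Y|$ neighbours. ${\#}_{\mathrm{dd}}(X)$ is the least integer $C>0$ such that $X$ admits a $C^{-1}$-dense auxiliary graph. For general $X$, ${\#}_{\mathrm{dd}}(X)=\max_{h}{\#}_{\mathrm{dd}}(\pi^{-1}(h)\cap X)$ over $h$ with nonempty fibre. *)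

(* Defs.v *)
From HB Require Import structures.
From mathcomp Require Import all_boot all_order all_algebra.
From mathcomp Require Import mpoly.
From mathcomp Require Import Rstruct.
From Stdlib Require Import ClassicalEpsilon.
Set Implicit Arguments. Unset Strict Implicit. Unset Printing Implicit Defensive.
Import Order.TTheory GRing.Theory Num.Theory.
Local Open Scope ring_scope.

Section Defs.
Variables (p d : nat).
Local Notation F := 'F_p.
Local Notation vec := 'rV[F]_d.
Local Notation poly := {mpoly F[d]}.

Definition pbool (P : Prop) : bool :=
  if excluded_middle_informative P then true else false.

Definition in_ideal (G : poly -> Prop) (f : poly) : Prop :=
  exists (n : nat) (g q : 'I_n -> poly),
    (forall i, G (q i)) /\ f = \sum_(i < n) g i * q i.

Definition quadpart (A : 'M[F]_d) : poly :=
  \sum_(i < d) \sum_(j < d) A i j *: ('X_i * 'X_j).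

Definition linpart (A : 'M[F]_d) (h : vec) : poly :=
  \sum_(j < d) (h *m A) 0 j *: 'X_j.

(* J^M_V ; it depends on M only through A *)
Definition JM (A : 'M[F]_d) (V : {vspace vec}) : poly -> Prop :=
  in_ideal (fun q => q = quadpart A \/ exists2 h, h \in V & q = linpart A h).

Definition Menergy (A : 'M[F]_d) (H : {set vec}) (xi : vec -> poly) : nat :=
  #|[set t : vec * vec * vec * vec |
     let: (h1, h2, h3, h4) := t in
     [&& h1 \in H, h2 \in H, h3 \in H, h4 \in H, h1 - h2 == h3 - h4 &
        pbool (JM A <<[:: h1; h2; h3; h4]>>%VS
                 (xi h1 - xi h2 - xi h3 + xi h4))]]|.

(* elements of Gamma^s(M): pairs (h, I + f), the coset being a set of polys *)
Definition GE := (vec * (poly -> Prop))%type.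

Definition coset (I : poly -> Prop) (f : poly) : poly -> Prop :=
  fun g => I (g - f).

(* the ideal I recovered from a coset I + f *)
Definition cideal (S : poly -> Prop) : poly -> Prop :=
  fun g => exists a b, S a /\ S b /\ g = a - b.

Definition sumset (S T : poly -> Prop) : poly -> Prop :=
  fun g => exists a b, S a /\ T b /\ g = a + b.

Definition gsim (x y : GE) : Prop :=
  x.1 = y.1 /\ exists f f', x.2 f /\ y.2 f' /\
     sumset (cideal x.2) (cideal y.2) (f - f').

Definition hplus (X Y : GE -> Prop) : GE -> Prop :=
  fun z => exists x y, X x /\ Y y /\ z = (x.1 + y.1, sumset x.2 y.2).

(* X admits a C^{-1}-dense auxiliary graph (Y finite, nonempty) *)
Definition admits_aux (X : GE -> Prop) (C : nat) : Prop :=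
  exists (Y : finType) (E : GE -> {set Y}),
    (0 < #|Y|)%N /\
    (forall x x' y, X x -> X x' -> x <> x' -> y \in E x -> y \in E x' ->
        gsim x x') /\
    (forall x, X x -> (#|Y| <= C * #|E x|)%N).

Definition ndd_fibre (X : GE -> Prop) : nat :=
  epsilon (inhabits 0%N) (fun C => (0 < C)%N /\ admits_aux X C /\
     forall C', (0 < C')%N -> admits_aux X C' -> (C <= C')%N).

Definition fibre (X : GE -> Prop) (h : vec) : GE -> Prop :=
  fun x => X x /\ x.1 = h.

Definition ndd (X : GE -> Prop) : nat :=
  \max_(h : vec | pbool (exists x, fibre X h x)) ndd_fibre (fibre X h).

Definition xitilde (A : 'M[F]_d) (xi : vec -> poly) (h : vec) : GE :=
  (h, coset (JM A <[h]>%VS) (xi h)).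

Definition ximage (A : 'M[F]_d) (xi : vec -> poly) (H : {set vec}) : GE -> Prop :=
  fun x => exists2 h, h \in H & x = xitilde A xi h.

End Defs.

(* Main.v *)
Require Import Defs.
From HB Require Import structures.
From mathcomp Require Import all_boot all_order all_algebra.
From mathcomp Require Import mpoly zify.
From mathcomp Require Import Rstruct.
From Stdlib Require Import ClassicalEpsilon.
Set Implicit Arguments. Unset Strict Implicit. Unset Printing Implicit Defensive.
Import Order.TTheory GRing.Theory Num.Theory.
Local Open Scope ring_scope.

(** The ideals [J_V] with [\dim V] small against [d] are prime with respect to
    linear forms, because the quadric and a linear form [l_w], [w \notin V], are
    a regular sequence modulo the linear forms of [V].  Hence a homogeneous [f]
    of degree [s] lying in [J_(V + w_i)] for [s + 1] vectors [w_i] independent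
    modulo [V] is divisible modulo [J_V] by the product of the [l_(w_i)], and so
    lies in [J_V].

    This elimination gives an approximate version of transitivity.  Attach to a
    pair [(a, b)] a [d]-tuple of elements [c_i] for which [(a, b, c_i, a+b-c_i)]
    is one of the quadruples counted by the energy: two pairs with a common
    tuple are related modulo the span of the pairs and any single [c_i], and if
    the [c_i] form a basis they can all be eliminated.  The tuples thus serve as
    labels, i.e. as the second side [Y] of an auxiliary graph, and popular pairs
    carry a positive proportion of all labels.  Labels compose along
    [a + e b = (a - w) + (w + e b)], the middle vector [w] being eliminated in
    the same way.

    Dependent random choice applied to the popular differences yields a dense
    [H'] all of whose differences are joined by many paths of length four, hence
    labelled.  By Cauchy-Schwarz [H'] then has large energy by itself, so many
    sums in [H'] are popular and labelled; a last composition
    [a + b = (a - u) + (u + b)] labels all sums of a dense subset of [H']. *)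

(** * The ideals [J_V] *)

Section InIdeal.
Variables (p d : nat).
Local Notation poly := {mpoly 'F_p[d]}.
Implicit Types (G : poly -> Prop) (f g q : poly).

Lemma in_ideal_ind G (P : poly -> Prop) :
    P 0 -> (forall f g, P f -> P g -> P (f + g)) ->
    (forall f q, G q -> P (f * q)) ->
  forall f, in_ideal G f -> P f.
Proof.
move=> P0 PD PM f [n [g [q [Gq ->]]]].
by apply: big_ind => // i _; apply: PM.
Qed.

Lemma in_idealMgen G f q : G q -> in_ideal G (f * q).
Proof.
by move=> Gq; exists 1%N, (fun=> f), (fun=> q); split=> //; rewrite big_ord1.
Qed.

Lemma in_ideal0 G : in_ideal G 0.
Proof.
by exists 0%N, (fun=> 0), (fun=> 0); split=> [[]//|]; rewrite big_ord0.
Qed.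

Lemma in_idealD G f g : in_ideal G f -> in_ideal G g -> in_ideal G (f + g).
Proof.
move=> [n [a [q [Gq ->]]]] [m [b [r [Gr ->]]]].
exists (n + m)%N, (fun i => match split i with inl j => a j | inr j => b j end),
  (fun i => match split i with inl j => q j | inr j => r j end).
split=> [i|]; first by case: (split i).
rewrite big_split_ord /=; congr (_ + _); apply: eq_bigr => i _.
  by rewrite (unsplitK (inl i)).
by rewrite (unsplitK (inr i)).
Qed.

Lemma in_idealMl G f g : in_ideal G g -> in_ideal G (f * g).
Proof.
elim/in_ideal_ind: g / => [|g h ? ?|g q Gq].
  by rewrite mulr0; apply: in_ideal0.
  by rewrite mulrDr; apply: in_idealD.
by rewrite mulrA; apply: in_idealMgen.
Qed.

Lemma in_idealN G f : in_ideal G f -> in_ideal G (- f).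
Proof. by rewrite -mulN1r; apply: in_idealMl. Qed.

Lemma in_idealB G f g : in_ideal G f -> in_ideal G g -> in_ideal G (f - g).
Proof. by move=> Gf /in_idealN; apply: in_idealD. Qed.

Lemma in_idealZ G c f : in_ideal G f -> in_ideal G (c *: f).
Proof. by rewrite -mul_mpolyC; apply: in_idealMl. Qed.

Lemma sub_in_ideal G G' f :
  (forall q, G q -> in_ideal G' q) -> in_ideal G f -> in_ideal G' f.
Proof.
move=> GG'; elim/in_ideal_ind: f / => [|? ? ? ?|? ? /GG'].
- exact: in_ideal0.
- exact: in_idealD.
- exact: in_idealMl.
Qed.

Lemma in_ideal_congrM G f f' g g' :
  in_ideal G (f - f') -> in_ideal G (g - g') -> in_ideal G (f * g - f' * g').
Proof.
move=> Gf Gg; have ->: f * g - f' * g' = g * (f - f') + f' * (g - g').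
  by rewrite !mulrBr (mulrC g f) (mulrC g f') addrA subrK.
by apply: in_idealD; apply: in_idealMl.
Qed.

Lemma in_ideal_congr_prod G (I : finType) (a b : I -> poly) :
  (forall i, in_ideal G (a i - b i)) ->
  in_ideal G (\prod_i a i - \prod_i b i).
Proof.
move=> ab; apply: (big_rec2 (fun f g => in_ideal G (f - g))) => [|i f g _].
  by rewrite subrr; apply: in_ideal0.
exact: in_ideal_congrM.
Qed.

Lemma in_ideal_congrX G f g m :
  in_ideal G (f - g) -> in_ideal G (f ^+ m - g ^+ m).
Proof.
move=> fg; elim: m => [|m IH]; first by rewrite subrr; apply: in_ideal0.
by rewrite !exprS; apply: in_ideal_congrM.
Qed.

Lemma in_ideal_comp_mpoly G (t : d.-tuple poly) f :
  (forall i, in_ideal G (tnth t i - 'X_i)) -> in_ideal G (f \mPo t - f).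
Proof.
move=> tX; elim/mpolyind: f => [|c m f _ _ IH].
  by rewrite comp_mpoly0 subrr; apply: in_ideal0.
rewrite comp_mpolyD comp_mpolyZ opprD addrACA -scalerBr.
apply: in_idealD => //; apply: in_idealZ; rewrite comp_mpolyX mpolyXE_id.
by apply: in_ideal_congr_prod => i; apply: in_ideal_congrX.
Qed.

End InIdeal.

(** * Linear forms and linear substitutions *)

Section LinearForm.
Variables (p d : nat).
Local Notation vec := 'rV['F_p]_d.
Local Notation poly := {mpoly 'F_p[d]}.
Implicit Types (u v : vec) (T A : 'M['F_p]_d) (f g : poly).

Definition linform u : poly := \sum_(j < d) u 0 j *: 'X_j.

Lemma linform_is_linear : linear linform.
Proof.
move=> c u v; rewrite /linform scaler_sumr -big_split /=.
by apply: eq_bigr => j _; rewrite !mxE scalerDl scalerA.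
Qed.

HB.instance Definition _ :=
  GRing.isLinear.Build 'F_p vec poly _ linform linform_is_linear.

Lemma mcoeff_linform u j : (linform u)@_U_(j) = u 0 j.
Proof.
rewrite raddf_sum /= (bigD1 j) //= mcoeffZ mcoeffX eqxx mulr1 big1 ?addr0 // => i.
by rewrite mcoeffZ mcoeffX eq_mnm1 => /negPf ->; rewrite mulr0.
Qed.

Lemma linform_eq0 u : (linform u == 0) = (u == 0).
Proof.
apply/eqP/eqP => [u0|->]; last by rewrite raddf0.
by apply/rowP => j; rewrite -mcoeff_linform u0 mcoeff0 mxE.
Qed.

Lemma linform_delta i : linform (delta_mx 0 i) = 'X_i.
Proof.
rewrite /linform (bigD1 i) //= mxE !eqxx scale1r big1 ?addr0 // => j /negPf ji.
by rewrite mxE ji andbF scale0r.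
Qed.

Lemma linform_homog u : linform u \is 1.-homog.
Proof.
by apply: rpred_sum => i _; apply: rpredZ; rewrite dhomogX /= mdeg1.
Qed.

Lemma linpartE A u : linpart A u = linform (u *m A).
Proof. by []. Qed.

End LinearForm.

(* Locked, so that failing unifications do not unfold [comp_mpoly]. *)
HB.lock Definition lsubst (p d : nat) (T : 'M['F_p]_d) (f : {mpoly 'F_p[d]})
  : {mpoly 'F_p[d]} := f \mPo [tuple linform (row i T) | i < d].

Section LinearSubst.
Variables (p d : nat).
Local Notation vec := 'rV['F_p]_d.
Local Notation poly := {mpoly 'F_p[d]}.
Implicit Types (u v : vec) (T A : 'M['F_p]_d) (f g : poly).

Lemma lsubstE T f : lsubst T f = f \mPo [tuple linform (row i T) | i < d].
Proof. by rewrite unlock. Qed.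

Lemma lsubst0 T : lsubst T 0 = 0.
Proof. by rewrite lsubstE comp_mpoly0. Qed.
Lemma lsubstD T : {morph lsubst T : f g / f + g}.
Proof. by move=> f g; rewrite !lsubstE comp_mpolyD. Qed.
Lemma lsubstM T : {morph lsubst T : f g / f * g}.
Proof. by move=> f g; rewrite !lsubstE rmorphM. Qed.
Lemma lsubstZ T c f : lsubst T (c *: f) = c *: lsubst T f.
Proof. by rewrite !lsubstE comp_mpolyZ. Qed.
Lemma lsubstXn T f m : lsubst T (f ^+ m) = lsubst T f ^+ m.
Proof. by rewrite !lsubstE rmorphXn. Qed.
Lemma lsubst_sum T (I : finType) (a : I -> poly) :
  lsubst T (\sum_i a i) = \sum_i lsubst T (a i).
Proof.
by rewrite lsubstE rmorph_sum; apply: eq_bigr => i _; rewrite lsubstE.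
Qed.
Lemma lsubst_prod T (I : finType) (a : I -> poly) :
  lsubst T (\prod_i a i) = \prod_i lsubst T (a i).
Proof.
by rewrite lsubstE rmorph_prod; apply: eq_bigr => i _; rewrite lsubstE.
Qed.

Lemma lsubstX T i : lsubst T 'X_i = linform (row i T).
Proof. by rewrite lsubstE comp_mpolyXU -tnth_nth tnth_mktuple. Qed.

Lemma lsubst_linform T u : lsubst T (linform u) = linform (u *m T).
Proof.
rewrite {1}/linform lsubst_sum mulmx_sum_row raddf_sum /=.
by apply: eq_bigr => i _; rewrite lsubstZ lsubstX [in RHS]linearZ.
Qed.

Lemma lsubst_comp S T f : lsubst T (lsubst S f) = lsubst (S *m T) f.
Proof.
have monom m : lsubst T (lsubst S 'X_[m]) = lsubst (S *m T) 'X_[m].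
  rewrite mpolyXE_id !lsubst_prod; apply: eq_bigr => i _.
  by rewrite !lsubstXn !lsubstX lsubst_linform row_mul.
have additive g h : lsubst T (lsubst S g) = lsubst (S *m T) g ->
    lsubst T (lsubst S h) = lsubst (S *m T) h ->
    lsubst T (lsubst S (g + h)) = lsubst (S *m T) (g + h).
  by rewrite !lsubstD => -> ->.
elim/mpolyind: f => [|c m f _ _ IH]; first by rewrite !lsubst0.
by apply: additive IH; rewrite 3!lsubstZ monom.
Qed.

Lemma quadpart_linform A : quadpart A = \sum_i 'X_i * linform (row i A).
Proof.
apply: eq_bigr => i _; rewrite /linform mulr_sumr; apply: eq_bigr => j _.
by rewrite mxE -scalerAr.
Qed.

Lemma lsubst_quadpart T A : lsubst T (quadpart A) = quadpart (T^T *m A *m T).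
Proof.
rewrite !quadpart_linform lsubst_sum.
under eq_bigr do rewrite lsubstM lsubstX lsubst_linform -row_mul /linform.
under eq_bigr do rewrite mulr_suml.
rewrite exchange_big /=; apply: eq_bigr => j _.
rewrite -mulmxA row_mul mulmx_sum_row raddf_sum mulr_sumr /=.
by apply: eq_bigr => i _; rewrite linearZ /= !mxE -scalerAl -scalerAr.
Qed.

Lemma meval_quadpart A v : (quadpart A).@[v 0] = (v *m A *m v^T) 0 0.
Proof.
rewrite /quadpart raddf_sum /= mxE.
under [RHS]eq_bigr => j _ do rewrite mxE mulr_suml.
rewrite exchange_big /=; apply: eq_bigr => i _; rewrite raddf_sum /=.
apply: eq_bigr => j _; rewrite mevalZ mevalM !mevalXU !mxE mulrA.
by congr (_ * _); rewrite mulrC.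
Qed.

(** Polarisation: a zero polynomial gives [b v v = 0] at every vector, so expanding
    [b (u + v) (u + v)] yields [2 b u v = 0], and [2] is invertible since [p] is odd. *)
Lemma quadpart_eq0 A :
  prime p -> (2 < p)%N -> A^T = A -> quadpart A = 0 -> A = 0.
Proof.
move=> pp p2 Asym A0; pose b u v := (u *m A *m v^T) 0 0.
have bDl u v w : b (u + v) w = b u w + b v w by rewrite /b !mulmxDl mxE.
have bDr u v w : b w (u + v) = b w u + b w v by rewrite /b linearD mulmxDr mxE.
have bC u v : b u v = b v u.
  by rewrite /b -[u *m A *m _]trmxK mxE !trmx_mul trmxK Asym mulmxA.
have b0 v : b v v = 0 by rewrite /b -meval_quadpart A0 meval0.
have two : (2%:R : 'F_p) != 0.
  by rewrite -(dvdn_pcharf (pchar_Fp pp)) gtnNdvd.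
have bb u v : b u v = 0.
  have := b0 (u + v); rewrite bDl !bDr !b0 add0r addr0 (bC v u) -mulr2n -mulr_natl.
  by move/eqP; rewrite mulf_eq0 (negPf two) => /eqP.
apply/matrixP => i j; rewrite [RHS]mxE -(bb (delta_mx 0 i) (delta_mx 0 j)).
by rewrite /b -rowE trmx_delta -colE !mxE.
Qed.

Lemma linform_prod_homog (l : seq vec) :
  \prod_(v <- l) linform v \is (size l).-homog.
Proof.
elim: l => [|v l IH]; first by rewrite big_nil dhomog1.
by rewrite big_cons; exact: dhomogM (linform_homog v) IH.
Qed.

(* The substitution [X |-> X - proj_W X] of linear forms, whose kernel is the
   ideal generated by the linear forms in [W]. *)
Definition kill (W : {vspace vec}) : 'M['F_p]_d := 1%:M - lin1_mx (projv W).

Implicit Types W : {vspace vec}.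

Lemma mul_kill W u : u *m kill W = u - projv W u.
Proof. by rewrite mulmxBr mulmx1 mul_rV_lin1. Qed.

Lemma mul_kill0 W u : u \in W -> u *m kill W = 0.
Proof. by move=> uW; rewrite mul_kill projv_id // subrr. Qed.

Lemma sub_mul_kill W u : u - u *m kill W \in W.
Proof. by rewrite mul_kill subKr memv_proj. Qed.

Lemma mul_kill_eq0 W u : (u *m kill W == 0) = (u \in W).
Proof.
apply/eqP/idP => [u0|/mul_kill0 //].
by rewrite -[u]subr0 -u0 sub_mul_kill.
Qed.

(** [kill W1] moves a vector by an element of [W1], and [kill W2] sends that element to zero. *)
Lemma mul_kill_absorb W1 W2 :
  (W1 <= W2)%VS -> kill W1 *m kill W2 = kill W2.
Proof.
move=> W12; apply/row_matrixP => i; rewrite !rowE mulmxA.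
apply/eqP; rewrite -subr_eq0 -mulmxBl mul_kill_eq0 -opprB memvN.
by apply: (subvP W12); apply: sub_mul_kill.
Qed.

(** The projection onto [W] factors through coordinates in a basis of [W], so its rank is at most
    [\dim W]; together with [kill W] it sums to the identity. *)
Lemma rank_kill W : (d <= \rank (kill W) + \dim W)%N.
Proof.
have rP : (\rank (lin1_mx (projv W)) <= \dim W)%N.
  pose B : 'M_(\dim W, d) := \matrix_k (vbasis W)`_k.
  have -> : lin1_mx (projv W) =
      (\matrix_(i, k) coord (vbasis W) k (projv W (delta_mx 0 i))) *m B.
    apply/row_matrixP => i.
    rewrite rowE mul_rV_lin1 [LHS](coord_vbasis (memv_proj _ _)).
    rewrite row_mul mulmx_sum_row; apply: eq_bigr => k _.
    by rewrite rowK !mxE.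
  by apply: leq_trans (mxrankM_maxr _ _) (rank_leq_row _).
have := mxrank_add (kill W) (lin1_mx (projv W)).
by rewrite subrK mxrank1 => /leq_trans; apply; rewrite leq_add2l.
Qed.

Lemma lsubst_kill_congr W f :
  in_ideal (fun q => exists2 u, u \in W & q = linform u) (lsubst (kill W) f - f).
Proof.
rewrite lsubstE; apply: in_ideal_comp_mpoly => i; rewrite tnth_mktuple.
rewrite -linform_delta -raddfB /= -[X in in_ideal _ X]mul1r rowE.
apply: in_idealMgen; eexists; last by [].
by rewrite -opprB memvN sub_mul_kill.
Qed.

End LinearSubst.

(** * Membership in [J_V] after killing its linear generators *)

Section JM.
Variables (p d : nat) (A : 'M['F_p]_d).
Local Notation vec := 'rV['F_p]_d.
Local Notation poly := {mpoly 'F_p[d]}.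
Implicit Types (V W U : {vspace vec}) (v w : vec) (f g : poly).

Lemma JM0 V : JM A V 0. Proof. exact: in_ideal0. Qed.
Lemma JMD V f g : JM A V f -> JM A V g -> JM A V (f + g).
Proof. exact: in_idealD. Qed.
Lemma JMB V f g : JM A V f -> JM A V g -> JM A V (f - g).
Proof. exact: in_idealB. Qed.
Lemma JMN V f : JM A V f -> JM A V (- f).
Proof. exact: in_idealN. Qed.

Lemma JMS V W f : (V <= W)%VS -> JM A V f -> JM A W f.
Proof.
move=> VW; apply: sub_in_ideal => q Gq; rewrite -[q]mul1r; apply: in_idealMgen.
by case: Gq => [|[h /(subvP VW)]]; [left | right; exists h].
Qed.

(** Coefficient vectors of the linear generators of [JM A V]. *)
Definition imA V : {vspace vec} := (linfun (mulmxr A) @: V)%VS.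

Lemma memv_imA V w : w \in V -> w *m A \in imA V.
Proof. by move=> wV; have := memv_img (linfun (mulmxr A)) wV; rewrite lfunE. Qed.

Lemma imAP V w : reflect (exists2 v, v \in V & w = v *m A) (w \in imA V).
Proof.
by apply: (iffP memv_imgP) => -[v vV ->]; exists v; rewrite ?lfunE.
Qed.

Definition restr V := lsubst (kill (imA V)).

(** Killing the linear generators leaves a principal ideal, generated by the restricted quadratic
    form. Conversely, [restr V g - g] lies in the ideal of these generators, so a factorisation
    after restriction lifts to [g]. *)
Lemma JM_restrP V g :
  JM A V g <-> exists k, restr V g = restr V (quadpart A) * k.
Proof.
split.
  elim/in_ideal_ind: g / => [|f g [k Ef] [l Eg]|f q [->|[h hV ->]]].
  - by exists 0; rewrite /restr lsubst0 mulr0.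
  - by exists (k + l); rewrite /restr lsubstD mulrDr -Ef -Eg.
  - by exists (restr V f); rewrite /restr lsubstM mulrC.
  - exists 0; rewrite /restr lsubstM linpartE lsubst_linform.
    by rewrite mul_kill0 ?memv_imA // raddf0 !mulr0.
case=> k Eg.
have congr f : JM A V (restr V f - f).
  apply: sub_in_ideal (lsubst_kill_congr _ _) => _ [_ /imAP[v vV ->] ->].
  by rewrite -[linform _]mul1r; apply: in_idealMgen; right; exists v.
have -> : g = - (restr V g - g) + ((restr V (quadpart A) - quadpart A) * k
    + quadpart A * k).
  by rewrite Eg mulrBl subrK opprB subrK.
apply: JMD; first exact: JMN.
apply: JMD; rewrite mulrC; first by apply: in_idealMl; apply: congr.
by apply: in_idealMgen; left.
Qed.

End JM.

(** * Cancellation and elimination for a non-degenerate form *)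

Section Nondegenerate.
Variables (p d : nat) (A : 'M['F_p]_d).
Hypotheses (p_prime : prime p) (p_gt2 : (2 < p)%N).
Hypotheses (A_sym : A^T = A) (detA : \det A != 0).
Local Notation vec := 'rV['F_p]_d.
Local Notation poly := {mpoly 'F_p[d]}.
Implicit Types (V W U : {vspace vec}) (v w : vec) (f g : poly).

Let Aunit : A \in unitmx. Proof. by rewrite unitmxE unitfE. Qed.

Lemma dim_imA V : (\dim (imA A V) <= \dim V)%N.
Proof. by rewrite -(limg_ker_dim (linfun (mulmxr A)) V) leq_addl. Qed.

Lemma mem_imA V w : (w *m A \in imA A V) = (w \in V).
Proof.
apply/idP/idP; last exact: memv_imA.
by case/imAP => v vV /(can_inj (mulmxK Aunit)) ->.
Qed.

(** Vanishing would mean [T^T A T = 0] for [T = kill W]. As [A] is invertible, twice the rank of [T]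
    would be at most [d], while that rank is at least [d - \dim W]. *)
Lemma quadpart_restr_neq0 W :
  (2 * \dim W < d)%N -> lsubst (kill W) (quadpart A) != 0.
Proof.
move=> dW; rewrite lsubst_quadpart; apply/eqP => /quadpart_eq0 T0.
have {}T0 : (kill W)^T *m A *m kill W = 0.
  by apply: T0; rewrite // !trmx_mul trmxK A_sym mulmxA.
have := mulmx0_rank_max T0; rewrite mxrankMfree ?row_free_unit // mxrank_tr.
have := rank_kill W; lia.
Qed.

(** Modulo the linear forms of [V] the hypothesis reads [l_w f = q k]. Killing [w] as well
    annihilates [l_w] but not [q], because [2 (\dim V + 1) < d]; hence [k] is a multiple of [l_w],
    which then cancels in a domain. *)
Lemma JM_cancel_linform V w f :
    (2 * (\dim V).+1 < d)%N -> w \notin V ->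
  JM A V (linform (w *m A) * f) -> JM A V f.
Proof.
move=> dV wV /JM_restrP[k]; rewrite /restr lsubstM.
set T1 := kill _; set q := quadpart A; set lw := linform _ => Ek.
pose W2 := imA A (V + <[w]>); pose T2 := kill W2.
have L1 g : lsubst T1 (lsubst T1 g) = lsubst T1 g.
  by rewrite lsubst_comp mul_kill_absorb.
have L2 g : lsubst T2 (lsubst T1 g) = lsubst T2 g.
  by rewrite lsubst_comp mul_kill_absorb //; apply: limgS; apply: addvSl.
have lw0 : lsubst T1 lw != 0.
  by rewrite lsubst_linform linform_eq0 mul_kill_eq0 mem_imA.
have lw2 : lsubst T2 lw = 0.
  rewrite lsubst_linform mul_kill0 ?raddf0 //.
  by rewrite mem_imA (subvP (addvSr _ _)) ?memv_line.
have q2 : lsubst T2 q != 0.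
  apply: quadpart_restr_neq0; have := dim_imA (V + <[w]>).
  have [+ _] := dimv_add_leqif V <[w]>; rewrite dim_vline -/W2.
  by case: (w != 0) => /=; lia.
have congr2 g :
    in_ideal (fun r => exists2 u, u \in W2 & r = linform u) (lsubst T2 g - g).
  exact: lsubst_kill_congr.
have T1V v : v \in V -> v *m A *m T1 = 0.
  by move=> vV; rewrite mul_kill0 // memv_imA.
have T1lw c : lsubst T1 (linform (c *: w *m A)) = c *: lsubst T1 lw.
  by rewrite -scalemxAl linearZ /= lsubstZ.
have T1l u : lsubst T1 (linform u) = linform (u *m T1) by apply: lsubst_linform.
have JMI k' : lsubst T1 f = lsubst T1 q * k' -> JM A V f.
  by move=> Ef; apply/JM_restrP; exists k'.
clearbody T1 T2 q lw.
have {}Ek : lsubst T1 lw * lsubst T1 f = lsubst T1 q * lsubst T1 k.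
  by have := congr1 (lsubst T1) Ek; rewrite !lsubstM !L1.
have k0 : lsubst T2 k = 0.
  have := congr1 (lsubst T2) Ek; rewrite !lsubstM !L2 lw2 mul0r => /esym/eqP.
  by rewrite mulf_eq0 (negPf q2) => /eqP.
(* A polynomial killed by [T2] lies in the ideal of the linear forms attached to [V + <[w]>]; [T1]
   annihilates those of [V] and leaves multiples of [l_w]. *)
have [k' Ek'] : exists k', lsubst T1 k = lsubst T1 lw * k'.
  have := congr2 k; rewrite k0 sub0r => /in_idealN.
  rewrite opprK; elim/in_ideal_ind: k / {Ek k0} => [|f1 f2 [k1 E1] [k2 E2]|g u].
  - by exists 0; rewrite lsubst0 mulr0.
  - by exists (k1 + k2); rewrite lsubstD mulrDr E1 E2.
  case=> _ /imAP[_ /memv_addP[v vV [_ /vlineP[c ->] ->]] ->] ->.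
  exists (c *: lsubst T1 g); rewrite lsubstM mulmxDl raddfD lsubstD T1l T1V //.
  by rewrite raddf0 add0r T1lw -!scalerAr mulrC.
apply: (JMI k'); apply: (mulfI lw0).
by rewrite Ek Ek' mulrCA.
Qed.

Lemma JM_line_factor V w f : JM A (V + <[w]>) f ->
  exists g h, JM A V h /\ f = linform (w *m A) * g + h.
Proof.
elim/in_ideal_ind: f / => [|f1 f2 [g1 [h1 [J1 ->]]] [g2 [h2 [J2 ->]]]|f q].
- by exists 0, 0; rewrite mulr0 addr0; split=> //; apply: JM0.
- exists (g1 + g2), (h1 + h2); split; first exact: JMD.
  by rewrite mulrDr addrACA.
case=> [->|[_ /memv_addP[v vV [_ /vlineP[c ->] ->]] ->]].
  exists 0, (f * quadpart A); split; last by rewrite mulr0 add0r.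
  by apply: in_idealMgen; left.
exists (c *: f), (f * linpart A v); split.
  by apply: in_idealMgen; right; exists v.
rewrite !linpartE mulmxDl -scalemxAl raddfD /= [X in _ + X]linearZ /= mulrDr addrC.
by rewrite -!scalerAr [f * linform (w *m A)]mulrC.
Qed.

Lemma dim_add1 V u : (\dim (V + <[u]>) <= (\dim V).+1)%N.
Proof.
have [+ _] := dimv_add_leqif V <[u]>; rewrite dim_vline.
by case: (u != 0) => /=; lia.
Qed.

Lemma dim_add_span V (l : seq vec) : (\dim (V + <<l>>) <= \dim V + size l)%N.
Proof.
have [+ _] := dimv_add_leqif V <<l>> => /leq_trans; apply.
by rewrite leq_add2l; apply: dim_span.
Qed.

(* [size l = \dim (V + <<l>>) - \dim V] says that [l] is free modulo [V]. *)
Lemma JM_factor V (l : seq vec) f :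
    (2 * (\dim V).+2 < d)%N -> \dim (V + <<l>>) = (\dim V + size l)%N ->
    (forall w, w \in l -> JM A (V + <[w]>) f) ->
  exists g h, JM A V h /\ f = (\prod_(w <- l) linform (w *m A)) * g + h.
Proof.
move=> dV; elim: l f => [|w l IH] f dl Jf.
  by exists f, 0; rewrite big_nil mul1r addr0; split=> //; apply: JM0.
move: dl; rewrite span_cons [(<[w]> + _)%VS]addvC addvA /= => dl.
have wl : w \notin (V + <<l>>)%VS.
  apply/negP => wl; move: dl.
  have -> : (V + <<l>> + <[w]> = V + <<l>>)%VS by apply/addv_idPl; rewrite -memvE.
  have := dim_add_span V l; lia.
have {}dl : \dim (V + <<l>>) = (\dim V + size l)%N.
  by have := dim_add1 (V + <<l>>)%VS w; rewrite dl; have := dim_add_span V l; lia.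
have /JM_line_factor[f1 [h1 [Jh1 Ef]]] := Jf w (mem_head _ _).
have [|g [h [Jh Ef1]]] := IH f1 dl.
  (* Since [l_w f1 = f - h1] lies in the ideal of [V + <[x]>] and [w] is outside that space, [l_w]
     cancels: [f1] inherits the hypothesis at each remaining [x]. *)
  move=> x xl; apply: (@JM_cancel_linform _ w).
  - by apply: leq_ltn_trans dV; rewrite leq_mul2l !ltnS dim_add1.
  - apply: contra wl; apply/subvP; apply: addvS => //.
    by rewrite -memvE; apply: memv_span.
  have -> : linform (w *m A) * f1 = f - h1 by rewrite Ef addrK.
  apply: JMB; first by apply: Jf; rewrite inE xl orbT.
  by apply: JMS Jh1; apply: addvSl.
exists g, (linform (w *m A) * h + h1); split.
  by apply: JMD => //; apply: in_idealMl.
by rewrite big_cons Ef Ef1 mulrDr addrA mulrA.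
Qed.

(** Greedy choice: a vector is kept exactly when it lies outside the span of [V] and the vectors
    already kept. *)
Lemma free_mod_subseq V (L : seq vec) : exists l : seq vec,
  [/\ {subset l <= L}, \dim (V + <<l>>) = (\dim V + size l)%N
    & (V + <<l>> = V + <<L>>)%VS].
Proof.
elim: L => [|w L [l [lL dl El]]].
  by exists [::]; split=> //; rewrite span_nil addv0 addn0.
have EwL : (V + <<w :: L>> = V + <<l>> + <[w]>)%VS.
  by rewrite span_cons [(<[w]> + _)%VS]addvC addvA El.
case: (boolP (w \in (V + <<l>>)%VS)) => wl.
  exists l; split=> //; first by move=> x /lL; rewrite inE orbC => ->.
  by rewrite EwL; apply/esym/addv_idPl; rewrite -memvE.
exists (w :: l); split.
- by move=> x; rewrite !inE => /orP[->//|/lL ->]; rewrite orbT.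
- rewrite span_cons [(<[w]> + _)%VS]addvC addvA dimv_disjoint_sum; last first.
    apply/eqP; rewrite -subv0; apply/subvP => x /memv_capP[xl /vlineP[c Ex]].
    rewrite memv0 Ex scaler_eq0; apply/orP; left; apply: contraR wl => c0.
    by rewrite -(scalerK c0 w) -Ex memvZ.
  rewrite dl dim_vline; have -> : w != 0 by apply: contraNneq wl => ->; apply: mem0v.
  by rewrite addn1 addnS.
- by rewrite EwL span_cons [(<[w]> + _)%VS]addvC addvA.
Qed.

(** Of the homogeneous components of [g] only that of degree [s - k] contributes. This makes [J_V] a
    homogeneous ideal, and kills in degree [s] any multiple of a product of more than [s] linear
    forms. *)
Lemma pihomogM k s (g h : poly) : h \is k.-homog ->
  pihomog mdeg s (g * h) = if (k <= s)%N then pihomog mdeg (s - k) g * h else 0.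
Proof.
move=> hk; have hom i : pihomog mdeg i g * h \is (i + k).-homog.
  by apply: dhomogM => //; apply: pihomogP.
have gE := pihomog_partitionE (leq_addl s.+1 (mmeasure mdeg g)).
rewrite {1}gE mulr_suml raddf_sum /=; case: leqP => ks; last first.
  by apply: big1 => i _; apply: pihomog_ne0 (hom i); lia.
have sk : (s - k < s.+1 + mmeasure mdeg g)%N by lia.
rewrite (bigD1 (Ordinal sk)) //= [X in X + _]pihomog_dE; last first.
  by have := hom (s - k)%N; rewrite subnK.
rewrite big1 ?addr0 // => i; rewrite -val_eqE /= => ne.
by apply: pihomog_ne0 (hom i); lia.
Qed.

Lemma JM_pihomog V s f : JM A V f -> JM A V (pihomog mdeg s f).
Proof.
elim/in_ideal_ind: f / => [|f g Jf Jg|f q Gq].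
- by rewrite pihomog0; apply: JM0.
- by rewrite pihomogD; apply: JMD.
have [k qk] : exists k, q \is k.-homog.
  case: Gq => [->|[h _ ->]]; last by exists 1%N; apply: linform_homog.
  exists 2%N; rewrite quadpart_linform; apply: rpred_sum => i _.
  by apply: (@dhomogM _ _ _ 1 _ 1); rewrite ?linform_homog // dhomogX /= mdeg1.
rewrite (pihomogM _ _ qk); case: ifP => _; last exact: JM0.
exact: in_idealMgen.
Qed.

(** Rows of [S] completing [V] to the whole space are chosen free modulo [V]. Modulo [J_V], [f] is a
    multiple of the product of their linear forms; this product has degree above [s], so the
    multiple has no component of degree [s]. *)
Lemma JM_of_basis V s f (S : 'M['F_p]_d) :
    (2 * s + 15 <= d)%N -> (\dim V <= 4)%N -> S \in unitmx -> f \is s.-homog ->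
  (forall i, JM A (V + <[row i S]>) f) -> JM A V f.
Proof.
move=> ds dV Sunit fs Jf; pose L := [seq row i S | i <- enum 'I_d].
have [l [lL dl El]] := free_mod_subseq V L.
have LT : (<<L>> = fullv)%VS.
  apply/eqP; rewrite eqEsubv subvf; apply/subvP => x _.
  rewrite -(mulmxKV Sunit x) mulmx_sum_row; apply: rpred_sum => i _; apply: rpredZ.
  by apply: memv_span; apply: map_f; rewrite mem_enum.
(* There are [d - \dim V >= 2 s + 11] vectors in [l]; likewise [2 (4 + 2) < 15 <= d] meets the
   dimension condition of [JM_factor]. *)
have sl : (s < size l)%N.
  move: dl; rewrite El LT addvf dimvf /dim /=; lia.
have [|w /lL /mapP[i _ ->] //|g [h [Jh Ef]]] := @JM_factor V l f _ dl.
  lia.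
rewrite -[f](pihomog_dE fs) Ef pihomogD; apply: JMD; last exact: JM_pihomog.
rewrite mulrC (pihomogM _ _ (k := size l)); last first.
  rewrite -(size_map (mulmxr A)) -(big_map (mulmxr A) predT (@linform p d)).
  exact: linform_prod_homog.
by rewrite leqNgt sl; apply: JM0.
Qed.

End Nondegenerate.

(** * Counting *)

Section Counting.
Local Open Scope nat_scope.
Variable X : finType.
Implicit Types (f : X -> nat).

Lemma card_fibres (Y : finType) (E : {set X * Y}) :
  #|E| = \sum_x #|[set y | (x, y) \in E]|.
Proof.
rewrite -sum1_card (eq_bigr (fun x => \sum_(y | (x, y) \in E) 1)) => [|x _].
  by rewrite pair_big_dep /=; apply: eq_bigl => -[].
by rewrite -sum1_card; apply: eq_bigl => y; rewrite inE.
Qed.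

(** Cauchy-Schwarz, from [2 x y <= x^2 + y^2] summed over all pairs. *)
Lemma leq_sqr_sum f : (\sum_x f x) ^ 2 <= #|X| * \sum_x f x ^ 2.
Proof.
rewrite -(leq_pmul2l (ltn0Sn 1)) expnS expn1 big_distrlr /=.
have -> : 2 * (#|X| * \sum_x f x ^ 2) = \sum_x \sum_y (f x ^ 2 + f y ^ 2).
  under [RHS]eq_bigr do rewrite big_split /= sum_nat_const.
  by rewrite big_split /= sum_nat_const -big_distrr /= addnn -mul2n.
rewrite big_distrr; apply: leq_sum => x _; rewrite big_distrr.
by apply: leq_sum => y _; apply: nat_Cauchy.
Qed.

(** Points below the threshold [k / (2 M)] contribute at most half of the assumed lower bound for
    the sum; every other point contributes at most [k]. *)
Lemma popularity f k M : (forall x, f x <= k) -> 0 < k ->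
  #|X| * k <= M * \sum_x f x -> #|X| <= 2 * M * #|[set x | k <= 2 * M * f x]|.
Proof.
move=> fk k0 Xk; set P := [set x | _].
have : 2 * M * \sum_x f x <= 2 * M * (#|P| * k) + #|X| * k.
  rewrite -mulnA [in X in _ <= _ + X]mulnC -!sum_nat_const mulnA.
  rewrite (bigID (mem P)) mulnDr leq_add //=.
    by rewrite leq_mul2l leq_sum ?orbT.
  rewrite big_distrr /= (mulnC k) -sum_nat_const [leqRHS](bigID (mem P)) /=.
  apply: leq_trans (leq_addl _ _); apply: leq_sum => x.
  by rewrite inE -ltnNge => /ltnW.
rewrite -(leq_pmul2r k0); nia.
Qed.

Definition codeg (D : rel X) a b := #|[set v | D a v && D b v]|.

(* Dependent random choice, with [H0 := D(-, z)] for a well-chosen [z]. *)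
Lemma dependent_random_choice (D : rel X) B : 0 < #|X| ->
    #|X| ^ 2 <= B * #|[set x | D x.1 x.2]| ->
    let De a b := #|X| <= 16 * B ^ 2 * codeg D a b in
  exists H' : {set X}, [/\ #|X| <= 4 * B * #|H'|,
    forall a, a \in H' -> exists z, D a z &
    forall a b, a \in H' -> b \in H' ->
      #|X| <= 4 * B * #|[set w | De a w && De w b]|].
Proof.
move=> X0 DB De; set n := #|X| in X0 DB *.
pose N z := [set a | D a z].
pose bad z := #|[set x : X * X | [&& x.1 \in N z, x.2 \in N z & ~~ De x.1 x.2]]|.
(* Cauchy-Schwarz for the in-degrees [#|N z|], whose sum is the number of edges. *)
have sumN : n ^ 3 <= B ^ 2 * \sum_z #|N z| ^ 2.
  have EN : #|[set x | D x.1 x.2]| = \sum_z #|N z|.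
    rewrite -sum1_card; under [RHS]eq_bigr do rewrite -sum1_card.
    rewrite (exchange_big_dep predT) //= pair_big_dep /=.
    by apply: eq_bigl => -[x y]; rewrite !inE.
  have := leq_sqr_sum (fun z => #|N z|); move: DB; rewrite EN -/n.
  set S := \sum_z _; set S2 := \sum_z _; move: S S2 => S S2 h1 h2.
  have : n ^ 2 * n ^ 2 <= B * S * (B * S) by apply: leq_mul.
  rewrite -(leq_pmul2l X0); nia.
(* A pair failing [De] is counted once per common out-neighbour, so fewer than [n / (16 B^2)] times,
   and there are [n^2] pairs in all. *)
have sumbad : 16 * B ^ 2 * \sum_z bad z <= n ^ 3.
  have -> : \sum_z bad z = \sum_(x : X * X | ~~ De x.1 x.2) codeg D x.1 x.2.
    rewrite /bad; under eq_bigr do rewrite -sum1_card.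
    rewrite (exchange_big_dep (fun x => ~~ De x.1 x.2)) /=; last first.
      by move=> z x _; rewrite inE => /and3P[].
    apply: eq_bigr => x nDe; rewrite /codeg -sum1_card; apply: eq_bigl => z.
    by rewrite !inE nDe andbT.
  rewrite big_distrr /=.
  apply: (@leq_trans (\sum_(x : X * X) n)); last first.
    by rewrite sum_nat_const card_prod; lia.
  rewrite [leqRHS](bigID (fun x => ~~ De x.1 x.2)) /=.
  apply: leq_trans (leq_addr _ _).
  by apply: leq_sum => x; rewrite -ltnNge => /ltnW.
(* Averaging over [z]: the two terms on the left sum to at most [n^3] each, the right side to at
   least [2 n^3]. *)
have [z Hz] : exists z, n ^ 2 + 16 * B ^ 2 * bad z <= 2 * B ^ 2 * #|N z| ^ 2.
  apply/existsP; apply: contraPT sumN; rewrite negb_exists => /forallP h.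
  have : \sum_z (2 * B ^ 2 * #|N z| ^ 2).+1 <= \sum_z (n ^ 2 + 16 * B ^ 2 * bad z).
    by apply: leq_sum => z _; rewrite ltnNge.
  under eq_bigr do rewrite -addn1.
  rewrite !big_split /= !sum_nat_const -!big_distrr /= -/n muln1.
  move: sumbad; set b := \sum_z _; set S := \sum_z _; move: b S => b S h1 h2.
  by apply/negP; lia.
have B0 : 0 < B by case: (B) DB => //; rewrite mul0n; nia.
have NB : n <= 2 * B * #|N z| by rewrite -leq_sqr; nia.
have badN : 8 * bad z <= #|N z| ^ 2.
  by rewrite -(@leq_pmul2l (2 * B ^ 2)); [nia | rewrite muln_gt0 expn_gt0 B0].
have N0 : 0 < #|N z| by case: #|N z| NB => //; lia.
(* Vertices with bad partners in more than a quarter of [N z] are discarded. At most half of [N z]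
   is lost, and any two survivors have at least half of [N z] as common good partners. *)
pose nd a := [set b in N z | ~~ De a b].
pose H' := [set a in N z | 4 * #|nd a| <= #|N z|].
have badE : bad z = \sum_(a in N z) #|nd a|.
  rewrite /bad card_fibres [in RHS]big_mkcond /=; apply: eq_bigr => a _.
  case: ifP; rewrite inE => aN; last by apply: eq_card0 => b; rewrite !inE /= aN.
  by apply: eq_card => b; rewrite !inE /= aN.
have HN : #|N z| <= 2 * #|H'|.
  have : #|N z :\: H'| * #|N z| <= 4 * bad z.
    rewrite badE -sum_nat_const big_distrr /=.
    rewrite [leqRHS](bigID (mem H')) /=; apply: leq_trans (leq_addl _ _).
    rewrite [leqRHS](eq_bigl (mem (N z :\: H'))) => [|a]; last first.
      by rewrite !inE /= andbC.
    apply: leq_sum => a; rewrite !inE => /andP[nH aN].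
    by move: nH; rewrite aN -ltnNge => /ltnW.
  have := cardsID H' (N z).
  have : #|N z :&: H'| <= #|H'| by apply/subset_leq_card/subsetIr.
  nia.
have Dsym a b : De a b = De b a.
  by congr (_ <= _ * _); apply: eq_card => v; rewrite !inE andbC.
exists H'; split.
- nia.
- by move=> a; rewrite !inE => /andP[Da _]; exists z.
move=> a b; rewrite !inE => /andP[_ na] /andP[_ nb].
apply: leq_trans NB _; set W := [set w | _].
have : #|N z| <= #|W| + #|nd a| + #|nd b|.
  rewrite -addnA; apply: leq_trans (_ : #|W :|: (nd a :|: nd b)| <= _).
    apply/subset_leq_card/subsetP => w wN; rewrite !inE in wN *.
    by rewrite wN /= (Dsym w b); case: (De a w); case: (De b w).
  apply: leq_trans (leq_card_setU _ _) _; rewrite leq_add2l.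
  exact: leq_card_setU.
nia.
Qed.

End Counting.

(** * Labels *)

Lemma pboolP (P : Prop) : reflect P (pbool P).
Proof. by rewrite /pbool; case: excluded_middle_informative => ?; constructor. Qed.

(** By the order of the general linear group, the singular proportion is [1 - \prod_i (1 - q^-i)];
    the Bernoulli-type induction [prod_lb] charges at most [1 / q] to each factor. *)
Lemma card_singular_mx (F : finFieldType) m : (0 < m)%N ->
  (#|F| * #|[set M : 'M[F]_m | M \notin unitmx]| <= m * #|F| ^ (m * m))%N.
Proof.
move=> m0; set q := #|F|.
have q0 : (0 < q)%N by apply/card_gt0P; exists 0.
have GL : (#|[set M : 'M[F]_m | M \in unitmx]|
    = q ^ 'C(m, 2) * \prod_(1 <= i < m.+1) (q ^ i - 1))%N.
  rewrite -card_GL //; case: m m0 => // m _.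
  rewrite cardsT card_sub.
  by apply: eq_card => M; rewrite inE.
have prod_lb k : (q * \prod_(1 <= i < k.+1) q ^ i <=
    q * \prod_(1 <= i < k.+1) (q ^ i - 1) + k * \prod_(1 <= i < k.+1) q ^ i)%N.
  elim: k => [|k IH]; first by rewrite !big_geq // leq_addr.
  rewrite !(big_nat_recr k.+1) //=.
  have qk : (0 < q ^ k)%N by rewrite expn_gt0 q0.
  move: IH; set P := (\prod_(_ <= _ < _) _)%N; set Q := (\prod_(_ <= _ < _) _)%N => IH.
  have QP : (Q <= P)%N by apply: leq_prod => i _; apply: leq_subr.
  have h1 : (q * Q <= P * q ^ k.+1)%N.
    by rewrite expnS mulnCA leq_mul2l -[Q]muln1 leq_mul ?orbT.
  have : (0 < q ^ k.+1)%N by rewrite expn_gt0 q0.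
  move: h1 IH; move: (q ^ k.+1)%N => [//|x] h1 IH _; rewrite subn1 /=.
  have := leq_mul IH (leqnn x.+1); nia.
have sum : (q ^ 'C(m, 2) * \prod_(1 <= i < m.+1) q ^ i = q ^ (m * m))%N.
  rewrite -expn_sum -expnD; congr (_ ^ _)%N.
  have -> : (\sum_(1 <= i < m.+1) i = 'C(m.+1, 2))%N.
    by rewrite -bin2_sum [RHS]big_ltn.
  elim: (m) => // k IH; have := binS k.+1 1; have := binS k 1; rewrite !bin1; lia.
have := cardsC [set M : 'M[F]_m | M \in unitmx]; rewrite card_mx GL.
have -> : ~: [set M : 'M[F]_m | M \in unitmx] = [set M | M \notin unitmx].
  by apply/setP => M; rewrite !inE.
rewrite -[#|F|]/q -sum; have := leq_mul (leqnn (q ^ 'C(m, 2))%N) (prod_lb m).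
move: (q ^ _)%N (\prod_(_ <= _ < _) _)%N (\prod_(_ <= _ < _) _)%N #|_|; nia.
Qed.

(** The middle terms cancel when [a + e b = (a - w) + (w + e b)] is composed. *)
Lemma sum_telescope (V : zmodType) (a b u a' b' u' : V) :
  a + b - a' - b' = (a - u - a' + u') + (u + b - u' - b').
Proof.
have -> : u + b - u' - b' = (u - u') + (b - b').
  by rewrite [u + b - u']addrAC !addrA.
have -> : a - u - a' + u' = (a - a') - (u - u').
  by rewrite [a - u - a']addrAC opprB !addrA [LHS]addrAC.
by rewrite addrA subrK addrA [a - a' + b]addrAC.
Qed.

Section Labels.
Variables (p d : nat) (A : 'M['F_p]_d) (xi : 'rV['F_p]_d -> {mpoly 'F_p[d]}).
Local Notation G := 'rV['F_p]_d.
Local Notation poly := {mpoly 'F_p[d]}.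
Implicit Types (e : 'F_p) (R : rel G) (C B : nat) (H : {set G}).

Definition span4 (a b c u : G) : {vspace G} := <<[:: a; b; c; u]>>%VS.

(** The sign [e = -1] treats differences and [e = 1] sums, so that both share the arguments
    below. *)
Definition gap e (a b a' b' : G) : poly := xi a + e *: xi b - xi a' - e *: xi b'.

(** An auxiliary graph of density [1 / C] whose first side consists of pairs; a single [Y] serves
    all values of [a + e b], that is, all fibres. *)
Definition labelled e R C := exists (Y : finType) (E : G -> G -> {set Y}),
  [/\ (0 < #|Y|)%N, forall a b, R a b -> (#|Y| <= C * #|E a b|)%N
    & forall a b a' b' y, R a b -> R a' b' -> a + e *: b = a' + e *: b' ->
      y \in E a b -> y \in E a' b' -> JM A (span4 a b a' b') (gap e a b a' b')].

(* Labels carry a vector [s] that has not been eliminated from the ideal. *)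
Definition prelabelled e R C := exists (Z : finType) (E : G -> G -> {set G * Z}),
  [/\ (0 < #|Z|)%N, forall a b, R a b -> (#|{: G * Z}| <= C * #|E a b|)%N
    & forall a b a' b' s z, R a b -> R a' b' -> a + e *: b = a' + e *: b' ->
      (s, z) \in E a b -> (s, z) \in E a' b' ->
      JM A (span4 a b a' b' + <[s]>) (gap e a b a' b')].

Lemma span4_sub (W : {vspace G}) a b c u :
  a \in W -> b \in W -> c \in W -> u \in W -> (span4 a b c u <= W)%VS.
Proof.
by move=> ? ? ? ?; apply/span_subvP => x; rewrite !inE => /or4P[] /eqP->.
Qed.

Lemma mem_span4 a b c u :
  [/\ a \in span4 a b c u, b \in span4 a b c u, c \in span4 a b c u
    & u \in span4 a b c u].
Proof. by split; apply: memv_span; rewrite !inE eqxx ?orbT. Qed.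

(** Swapping the entries negates both difference and gap; this lets a path traverse an edge
    backwards. *)
Lemma labelled_flip R C : labelled (-1) R C -> labelled (-1) (fun a b => R b a) C.
Proof.
case=> Y [E [Y0 dE shE]]; exists Y, (fun a b => E b a); split=> // [a b /dE//|].
move=> a b a' b' y Rab Rab' Eab yE yE'.
have {}Eab : b + -1 *: a = b' + -1 *: a'.
  apply: oppr_inj; rewrite !scaleN1r in Eab *.
  by rewrite !opprB.
have /JMN := shE _ _ _ _ _ Rab Rab' Eab yE yE'.
have -> : - gap (-1) b a b' a' = gap (-1) a b a' b'.
  rewrite /gap !scaleN1r !opprD !opprK.
  by rewrite [- xi b + _]addrC -!addrA; congr (_ + (_ + _)); rewrite addrC.
apply: JMS; have [? ? ? ?] := mem_span4 a b a' b'; exact: span4_sub.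
Qed.

Section Sampling.
Variable s : nat.
Hypotheses (ds : (2 * s + 15 <= d)%N) (p_prime : prime p) (p_gt2 : (2 < p)%N).
Hypotheses (A_sym : A^T = A) (detA : \det A != 0).
Variable H : {set G}.
Hypothesis xi_homog : forall h, h \in H -> xi h \is s.-homog.

(** Labels are [d]-tuples of prelabels whose vectors form a basis. A shared tuple puts the gap in
    the ideal enlarged by each basis vector in turn, and [JM_of_basis] eliminates them all. Tuples
    have density [C^-d]; singular ones, of density at most [d / p], use up at most half of it. *)
Lemma prelabelled_labelled e R C : (2 * d * C ^ d <= p)%N ->
    (forall a b, R a b -> (a \in H) && (b \in H)) ->
  prelabelled e R C -> labelled e R (2 * C ^ d).
Proof.
move=> pC RH [Z [E [Z0 dE shE]]].
have d0 : (0 < d)%N by lia.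
pose Y := {ffun 'I_d -> G * Z}; pose mat (y : Y) : 'M['F_p]_d := \matrix_i (y i).1.
exists Y, (fun a b => [set y : Y | [forall i, y i \in E a b] & mat y \in unitmx]).
have cY : #|Y| = (#|{: G * Z}| ^ d)%N by rewrite card_ffun card_ord.
split=> [|a b /dE cE|a b a' b' y Rab Rab' Eab].
- rewrite cY expn_gt0 card_prod muln_gt0 Z0; apply/orP; left; rewrite andbT.
  by apply/card_gt0P; exists 0.
- set E' := [set y | _]; change (#|Y| <= 2 * C ^ d * #|E'|)%N.
  pose sing := [set y : Y | mat y \notin unitmx].
  have csing : (p * #|sing| <= d * #|Y|)%N.
    (* A tuple is regrouped as a matrix and a tuple in [Z], so that counting singular matrices
       suffices. *)
    pose f (y : Y) := (mat y, [ffun i => (y i).2] : {ffun 'I_d -> Z}).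
    have f_inj : injective f.
      move=> y y' [/row_matrixP my /ffunP zy]; apply/ffunP => i.
      have := my i; have := zy i; rewrite !rowK !ffunE.
      by case: (y i) (y' i) => [? ?] [? ?] /= -> ->.
    have : (#|f @: sing| <= #|setX [set M : 'M['F_p]_d | M \notin unitmx]
        [set: {ffun 'I_d -> Z}]|)%N.
      apply/subset_leq_card/subsetP => _ /imsetP[y ys ->].
      by rewrite inE in ys; rewrite inE /= !inE andbT.
    rewrite card_imset // cardsX cardsT card_ffun card_ord => cs.
    apply: leq_trans (leq_mul (leqnn p) cs) _.
    have := card_singular_mx 'F_p d0; rewrite card_Fp // => cm.
    rewrite mulnA; apply: leq_trans (leq_mul cm (leqnn _)) _.
    by rewrite cY card_prod card_mx card_Fp // mul1n -mulnA expnMn -expnM.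
  have cEd : (#|E a b| ^ d <= #|E'| + #|sing|)%N.
    rewrite -[X in (_ ^ X)%N](card_ord d) -card_ffun_on.
    apply: leq_trans (_ : #|E' :|: sing| <= _)%N; last exact: leq_card_setU.
    apply/subset_leq_card/subsetP => y /ffun_onP yE; rewrite !inE.
    by case: (mat y \in unitmx); rewrite ?orbT //= andbT orbF; apply/forallP.
  have cYE : (#|Y| <= C ^ d * #|E a b| ^ d)%N by rewrite cY -expnMn leq_exp2r.
  have h : (2 * C ^ d * #|sing| <= #|Y|)%N.
    rewrite -(leq_pmul2l d0); apply: leq_trans csing.
    by rewrite mulnA leq_mul2r mulnCA mulnA pC orbT.
  move: cYE h cEd; move: (C ^ d)%N (#|E a b| ^ d)%N => c x h1 h2 h3.
  have := leq_mul (leqnn c) h3; nia.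
rewrite !inE => /andP[/forallP yE yu] /andP[/forallP yE' _].
have /andP[aH bH] := RH _ _ Rab; have /andP[aH' bH'] := RH _ _ Rab'.
apply: (JM_of_basis p_prime p_gt2 A_sym detA ds _ yu).
- exact: dim_span.
- by rewrite /gap; rewrite !(rpredD, rpredB, rpredZ, rpredN) ?xi_homog.
move=> i; rewrite rowK; apply: (shE _ _ _ _ _ (y i).2) => //.
  by rewrite -surjective_pairing.
by rewrite -surjective_pairing.
Qed.

End Sampling.

(** The retained vector is the difference [t = a - w] instead of [w]: a common [t] gives
    [a - w = a' - w'] and [w + e b = w' + e b'], as the comparison of labels requires, and [w], [w']
    lie in the span of the two pairs and [t]. *)
Lemma prelabelled_comp e R1 R2 R B C1 C2 :
    labelled (-1) R1 C1 -> labelled e R2 C2 ->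
    (forall a b, R a b -> (#|{: G}| <= B * #|[set w | R1 a w && R2 w b]|)%N) ->
  prelabelled e R (B * C1 * C2).
Proof.
case=> Y1 [E1 [Y10 dE1 sh1]] [Y2 [E2 [Y20 dE2 sh2]]] RB.
pose E a b : {set G * (Y1 * Y2)} := [set x | let w := a - x.1 in
  [&& R1 a w, R2 w b, x.2.1 \in E1 a w & x.2.2 \in E2 w b]].
exists (Y1 * Y2)%type, E; split=> [|a b Rab|a b a' b' t [z1 z2] _ _ Eab].
- by rewrite card_prod muln_gt0 Y10.
(* The substitution [t = a - w] turns the sum over retained vectors into one over middle vectors. *)
- rewrite card_fibres (reindex_inj (@subrI _ a)) /=.
  pose F w := [set y | (a - w, y) \in E a b].
  have cF w : R1 a w && R2 w b -> #|F w| = (#|E1 a w| * #|E2 w b|)%N.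
    move=> /andP[R1w R2w]; rewrite -cardsX; apply: eq_card => -[y1 y2].
    by rewrite !inE /= subKr R1w R2w.
  set W := [set w | R1 a w && R2 w b].
  have h : (#|W| * (#|Y1| * #|Y2|) <= C1 * C2 * \sum_w #|F w|)%N.
    rewrite -sum_nat_const [X in (_ <= _ * X)%N](bigID (mem W)) /=.
    rewrite mulnDr; apply: leq_trans (leq_addr _ _); rewrite big_distrr /=.
    apply: leq_sum => w; rewrite inE => Rw; rewrite (cF w Rw).
    by have /andP[/dE1 h1 /dE2 h2] := Rw; rewrite mulnACA; apply: leq_mul.
  rewrite 2!card_prod.
  have := leq_mul (RB _ _ Rab) (leqnn (#|Y1| * #|Y2|)%N).
  move/leq_trans; apply; move: h; rewrite -!mulnA => h.
  exact: leq_mul (leqnn B) h.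
rewrite !inE /=; set w := a - t; set w' := a' - t.
move=> /and4P[R1w R2w z1E z2E] /and4P[R1w' R2w' z1E' z2E'].
have E1' : a + -1 *: w = a' + -1 *: w' by rewrite !scaleN1r !subKr.
have E2' : w + e *: b = w' + e *: b' by rewrite /w /w' ![_ - t + _]addrAC Eab.
have [ma mb ma' mb'] := mem_span4 a b a' b'.
have inl x : x \in span4 a b a' b' -> x \in (span4 a b a' b' + <[t]>)%VS.
  exact/subvP/addvSl.
have tin : t \in (span4 a b a' b' + <[t]>)%VS.
  by apply: (subvP (addvSr _ _)); apply: memv_line.
have win : w \in (span4 a b a' b' + <[t]>)%VS by exact: rpredB (inl _ ma) tin.
have win' : w' \in (span4 a b a' b' + <[t]>)%VS by exact: rpredB (inl _ ma') tin.
have -> : gap e a b a' b' = gap (-1) a w a' w' + gap e w b w' b'.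
  by rewrite /gap !scaleN1r opprK; apply: sum_telescope.
apply: JMD.
  apply: JMS (sh1 _ _ _ _ _ R1w R1w' E1' z1E z1E').
  by apply: span4_sub; rewrite // inl.
apply: JMS (sh2 _ _ _ _ _ R2w R2w' E2' z2E z2E').
by apply: span4_sub; rewrite // inl.
Qed.

End Labels.

(** * Popular pairs and energy *)

Lemma leq_card_in_inj (X Y : finType) (f : X -> Y) (S : {set X}) (T : {set Y}) :
  {in S &, injective f} -> (forall x, x \in S -> f x \in T) -> (#|S| <= #|T|)%N.
Proof.
move=> f_inj fT; rewrite -(card_in_imset f_inj).
by apply/subset_leq_card/subsetP => _ /imsetP[x xS ->]; apply: fT.
Qed.

Lemma sum_cancel (V : zmodType) (x y x' y' c u : V) :
  x + y - x' - y' = (x + y - c - u) - (x' + y' - c - u).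
Proof.
rewrite -[x + y - c - u]addrA -[x' + y' - c - u]addrA -[LHS]addrA -!opprD.
by rewrite opprB addrA subrK.
Qed.

Section Energy.
Variables (p d : nat) (A : 'M['F_p]_d) (xi : 'rV['F_p]_d -> {mpoly 'F_p[d]}).
Local Notation G := 'rV['F_p]_d.
Local Notation labelled := (labelled A xi).
Local Notation prelabelled := (prelabelled A xi).
Local Notation gap := (gap xi).
Implicit Types (e : 'F_p) (k M C : nat) (H : {set G}).

(* [(a, b, c)] encodes the quadruple with [a + e b = c + e (b + e (a - c))]. *)
Definition quads e H : {set G * G * G} := [set t | let: (a, b, c) := t in
  [&& a \in H, b \in H, c \in H, b + e *: (a - c) \in H &
   pbool (JM A (span4 a b c (b + e *: (a - c))) (gap e a b c (b + e *: (a - c))))]].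

Definition popular e H k : rel G :=
  fun a b => (#|{: G}| <= k * #|[set c | ((a, b), c) \in quads e H]|)%N.

Lemma card_G_gt0 : (0 < #|{: G}|)%N.
Proof. by apply/card_gt0P; exists 0. Qed.

Lemma popular_mem e H k a b : popular e H k a b -> (a \in H) && (b \in H).
Proof.
rewrite /popular => h; have : (0 < #|[set c | ((a, b), c) \in quads e H]|)%N.
  by case: #|[set c | _]| h => //; rewrite muln0 leqNgt card_G_gt0.
by case/card_gt0P => c; rewrite !inE => /and5P[-> ->].
Qed.

Lemma card_popular e H M : (#|{: G}| ^ 3 <= M * #|quads e H|)%N ->
  (#|{: G}| ^ 2 <= 2 * M * #|[set x | popular e H (2 * M) x.1 x.2]|)%N.
Proof.
rewrite card_fibres => h.
have := @popularity (G * G)%type (fun x => #|[set c | (x, c) \in quads e H]|) #|{: G}| M.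
rewrite card_prod mulnn -expnSr => /(_ (fun=> max_card _) card_G_gt0 h).
move/leq_trans; apply; rewrite leq_mul2l subset_leq_card ?orbT //.
by apply/subsetP => -[a b]; rewrite !inE.
Qed.

(** The retained vector is [c]. As [e^2 = 1], the fourth vector [u = e (a + e b - c)] is the same
    for both pairs, so subtracting their relations cancels the terms in [c] and [u]; moreover [u]
    lies in the span of [a], [b], [c]. *)
Lemma popular_prelabelled e H k : e * e = 1 -> prelabelled e (popular e H k) k.
Proof.
move=> ee; exists unit, (fun a b => [set x : G * unit | ((a, b), x.1) \in quads e H]).
split=> [|a b Rab|a b a' b' c [] _ _ Eab]; first by rewrite card_unit.
  rewrite card_prod card_unit muln1; apply: leq_trans Rab _; rewrite leq_mul2l.
  apply/orP; right; apply: (@leq_card_in_inj _ _ (fun c => (c, tt))).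
    by move=> x y _ _ [].
  by move=> c; rewrite !inE.
rewrite !inE /= => /and5P[_ _ _ _ /pboolP Q] /and5P[_ _ _ _ /pboolP Q'].
have Eu : b + e *: (a - c) = b' + e *: (a' - c).
  rewrite -[LHS]scale1r -[RHS]scale1r -ee -!scalerA; congr (_ *: _).
  rewrite !scalerDr !scalerA ee !scale1r !addrA.
  by rewrite [e *: b + a]addrC [e *: b' + a']addrC Eab.
rewrite -Eu in Q'; set u := b + _ in Q Q'.
have [ma mb ma' mb'] := mem_span4 a b a' b'.
have inl x : x \in span4 a b a' b' -> x \in (span4 a b a' b' + <[c]>)%VS.
  exact/subvP/addvSl.
have cin : c \in (span4 a b a' b' + <[c]>)%VS.
  by apply: (subvP (addvSr _ _)); apply: memv_line.
have uin : u \in (span4 a b a' b' + <[c]>)%VS.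
  by apply: rpredD; [apply: inl | apply: rpredZ; apply: rpredB; rewrite // inl].
have -> : gap e a b a' b' = gap e a b c u - gap e a' b' c u.
  exact: sum_cancel.
by apply: JMB; [apply: JMS Q | apply: JMS Q']; apply: span4_sub; rewrite // inl.
Qed.

(** Rewriting [a - b = c - u] as [a + u = c + b] preserves the gap and the span. *)
Lemma card_quads_diff_sum H : (#|quads (-1)%R H| <= #|quads 1%R H|)%N.
Proof.
pose f (t : G * G * G) := let: (a, b, c) := t in (a, b + (-1) *: (a - c), c).
apply: (@leq_card_in_inj _ _ f).
  move=> [[a b] c] [[a' b'] c'] _ _ [Ea Eb Ec].
  by rewrite Ea Ec in Eb *; rewrite (addIr _ Eb).
move=> [[a b] c]; rewrite inE => /and5P[aH bH cH uH /pboolP Q].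
have Eb : b + -1 *: (a - c) + 1 *: (a - c) = b by rewrite scaleN1r scale1r subrK.
rewrite inE /= Eb aH bH cH uH; apply/pboolP; set u := b + _ in Q *.
have -> : gap 1 a u c b = gap (-1) a b c u.
  rewrite /gap !scaleN1r !scale1r opprK.
  by rewrite [RHS]addrAC [xi a - _ + _]addrAC [RHS]addrAC.
by have [? ? ? ?] := mem_span4 a u c b; apply: JMS Q; apply: span4_sub.
Qed.

Lemma Menergy_le_quads H : (Menergy A H xi <= #|quads (-1)%R H|)%N.
Proof.
apply: (@leq_card_in_inj _ _ (fun t : G * G * G * G => t.1)).
  move=> [[[a b] c] u] [[[a' b'] c'] u']; rewrite !inE /=.
  move=> /and5P[_ _ _ _ /andP[/eqP E _]] /and5P[_ _ _ _ /andP[/eqP E' _]].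
  move=> [Ea Eb Ec]; rewrite Ea Eb Ec E' in E *.
  by rewrite (oppr_inj (addrI _ E)).
move=> [[[a b] c] u]; rewrite inE => /and5P[aH bH cH uH /andP[/eqP E Q]].
have Eu : b + -1 *: (a - c) = u.
  rewrite scaleN1r opprB addrCA -opprB -/(c - (a - b)) E.
  by rewrite opprB addrC subrK.
by rewrite inE /= aH bH cH Eu uH /gap !scaleN1r opprK.
Qed.

(** [F (t, y)] collects the [a] for which [(a, a - t)] carries the label [y]. These sets have total
    size at least [|H|^2 |Y| / C], and two members [a], [c] of one set give the quadruple
    [(a, a - t, c, c - t)]; Cauchy-Schwarz over the [|G| |Y|] sets concludes. *)
Lemma labelled_quads (R : rel G) C H : labelled (-1) R C ->
    (forall a b, a \in H -> b \in H -> R a b) ->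
  (#|H| ^ 4 <= C ^ 2 * #|{: G}| * #|quads (-1)%R H|)%N.
Proof.
case=> Y [E [Y0 dE shE]] HR.
pose F (x : G * Y) := [set a | [&& a \in H, a - x.1 \in H & x.2 \in E a (a - x.1)]].
pose S1 := (\sum_x #|F x|)%N; pose S2 := (\sum_x #|F x| ^ 2)%N.
have lb : (#|H| ^ 2 * #|Y| <= C * S1)%N.
  pose S' : {set G * G * Y} :=
    [set z | [&& z.1.1 \in H, z.1.2 \in H & z.2 \in E z.1.1 z.1.2]].
  pose S : {set G * Y * G} := [set z | z.2 \in F z.1].
  have -> : S1 = #|S|.
    rewrite card_fibres; apply: eq_bigr => x _.
    by apply: eq_card => a; rewrite !inE.
  apply: (@leq_trans (C * #|S'|)%N); last first.
    rewrite leq_mul2l; apply/orP; right.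
    apply: (@leq_card_in_inj _ _ (fun z : G * G * Y => (z.1.1 - z.1.2, z.2, z.1.1))).
      move=> [[a b] y] [[a' b'] y'] _ _ /= [+ -> Ea]; rewrite Ea => Eb.
      by rewrite (oppr_inj (addrI _ Eb)).
    by move=> [[a b] y]; rewrite !inE /= subKr.
  rewrite card_fibres big_distrr /= -mulnn -cardsX -sum_nat_const.
  rewrite [leqRHS](bigID (mem (setX H H))) /=; apply: leq_trans (leq_addr _ _).
  apply: leq_sum => -[a b]; rewrite inE /= => /andP[aH bH].
  apply: leq_trans (dE _ _ (HR _ _ aH bH)) _.
  rewrite leq_mul2l subset_leq_card ?orbT //.
  by apply/subsetP => y yE; rewrite !inE /= aH bH.
have ub : (S2 <= #|quads (-1)%R H| * #|Y|)%N.
  pose S : {set G * Y * (G * G)} := [set z | (z.2.1 \in F z.1) && (z.2.2 \in F z.1)].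
  have -> : S2 = #|S|.
    rewrite card_fibres; apply: eq_bigr => x _; rewrite -mulnn -cardsX.
    by apply: eq_card => -[a c]; rewrite !inE.
  rewrite -cardsT -cardsX.
  apply: (@leq_card_in_inj _ _ (fun z => (z.2.1, z.2.1 - z.1.1, z.2.2, z.1.2))).
    move=> [[t y] [a c]] [[t' y'] [a' c']] _ _ /= [Ea Et -> ->].
    by rewrite Ea in Et *; rewrite (oppr_inj (addrI _ Et)).
  move=> [[t y] [a c]]; rewrite !inE /=.
  move=> /andP[/and3P[aH bH yE] /and3P[cH uH yE']].
  have -> : a - t + -1 *: (a - c) = c - t.
    by rewrite scaleN1r opprB addrC addrA subrK.
  rewrite aH bH cH uH andbT /=; apply/pboolP; apply: (shE _ _ _ _ y); rewrite ?HR //.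
  by rewrite !scaleN1r !subKr.
have cs : (S1 ^ 2 <= #|{: G}| * #|Y| * S2)%N.
  by rewrite -card_prod; apply: leq_sqr_sum.
have Y20 : (0 < #|Y| ^ 2)%N by rewrite expn_gt0 Y0.
rewrite -(leq_pmul2r Y20).
have h1 : (#|H| ^ 4 * #|Y| ^ 2 <= C ^ 2 * S1 ^ 2)%N.
  have := leq_mul lb lb; rewrite -!expnMn !mulnn; lia.
apply: leq_trans h1 _.
have h2 := leq_trans cs (leq_mul (leqnn _) ub).
have {h2} := leq_mul (leqnn (C ^ 2)%N) h2; move/leq_trans; apply.
by rewrite -mulnn; apply: eq_leq; lia.
Qed.

End Energy.

(** * From labels to dense auxiliary graphs *)

Section DensityDependence.
Variables (p d : nat) (A : 'M['F_p]_d) (xi : 'rV['F_p]_d -> {mpoly 'F_p[d]}).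
Local Notation G := 'rV['F_p]_d.
Local Notation poly := {mpoly 'F_p[d]}.
Local Notation GE := (GE p d).

(** Linear generators split along [v + w], and the quadratic one goes to [J_V]. This matches [gsim],
    which works modulo a sum of ideals. *)
Lemma JM_add (V W : {vspace G}) g : JM A (V + W) g ->
  exists u v, [/\ JM A V u, JM A W v & g = u + v].
Proof.
elim/in_ideal_ind: g / => [|f g [u [v [? ? ->]]] [u' [v' [? ? ->]]]|f q].
- by exists 0, 0; rewrite addr0; split=> //; apply: JM0.
- by exists (u + u'), (v + v'); rewrite addrACA; split=> //; apply: JMD.
case=> [->|[_ /memv_addP[v vV [w wW ->]] ->]].
  exists (f * quadpart A), 0; rewrite addr0; split=> //; last exact: JM0.
  by apply: in_idealMgen; left.
exists (f * linpart A v), (f * linpart A w); split.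
- by apply: in_idealMgen; right; exists v.
- by apply: in_idealMgen; right; exists w.
- by rewrite !linpartE mulmxDl raddfD mulrDr.
Qed.

Definition pairGE (ab : G * G) : GE :=
  (ab.1 + ab.2, sumset (xitilde A xi ab.1).2 (xitilde A xi ab.2).2).

Lemma pairGE_mem a b u v : JM A <[a]>%VS u -> JM A <[b]>%VS v ->
  (pairGE (a, b)).2 (xi a + u + (xi b + v)).
Proof.
move=> Ju Jv; exists (xi a + u), (xi b + v); rewrite /= /coset.
by rewrite [xi a + u - _]addrAC [xi b + v - _]addrAC !subrr !add0r.
Qed.

Lemma gsim_pairGE a b a' b' : a + b = a' + b' ->
  JM A (span4 a b a' b') (gap xi 1 a b a' b') ->
  gsim (pairGE (a, b)) (pairGE (a', b')).
Proof.
move=> Eab J; split=> //.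
have Jg x : JM A <[x]>%VS 0 by apply: JM0.
have xab := pairGE_mem (Jg a) (Jg b); have xab' := pairGE_mem (Jg a') (Jg b').
rewrite !addr0 in xab xab'.
exists (xi a + xi b), (xi a' + xi b'); split=> //; split=> //.
(* Splitting line by line, the parts for [a], [b] add up to an element of the ideal of the first
   coset, those for [a'], [b'] to one of the second. *)
have : JM A ((<[a]> + <[b]>) + (<[a']> + <[b']>)) (xi a + xi b - (xi a' + xi b')).
  have -> : xi a + xi b - (xi a' + xi b') = gap xi 1 a b a' b'.
    by rewrite /gap !scale1r opprD addrA.
  by apply: JMS J; rewrite /span4 !span_cons span_nil addv0 !addvA.
case/JM_add => _ [_ [/JM_add[u [v [Ju Jv ->]]] /JM_add[u' [v' [Ju' Jv' ->]]] E]].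
exists (u + v), (u' + v'); split; last split=> //.
  exists (xi a + u + (xi b + v)), (xi a + xi b); split; first exact: pairGE_mem.
  by split=> //; rewrite addrACA [X in _ = X]addrAC subrr add0r.
exists (xi a' + u' + (xi b' + v')), (xi a' + xi b'); split; first exact: pairGE_mem.
by split=> //; rewrite addrACA [X in _ = X]addrAC subrr add0r.
Qed.

(** The property defining the [epsilon] is available once a least admissible integer is known to
    exist; [C] and well-ordering provide one. *)
Lemma ndd_fibre_le (X : GE -> Prop) C : (0 < C)%N -> admits_aux X C ->
  (ndd_fibre X <= C)%N.
Proof.
move=> C0 XC; rewrite /ndd_fibre; set P := fun _ => _.
have /(epsilon_spec (inhabits 0%N) P)[_ [_]] : exists m, P m; last by apply.
have [m /andP[m0 /pboolP Xm] m_min] :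
    {m | (0 < m)%N && pbool (admits_aux X m) &
      forall k, (0 < k)%N && pbool (admits_aux X k) -> (m <= k)%N}.
  have : exists m, (0 < m)%N && pbool (admits_aux X m).
    by exists C; rewrite C0; apply/pboolP.
  by move=> h; case: (ex_minnP h) => m; exists m.
exists m; do 2!split=> //; move=> k k0 Xk; apply: m_min; rewrite k0.
exact/pboolP.
Qed.

(** Different pairs may give the same element of the sumset; [rep] fixes one pair, whose labels
    become the neighbours of the element. *)
Lemma labelled_ndd (H : {set G}) C : (0 < C)%N ->
    labelled A xi 1 (fun a b => (a \in H) && (b \in H)) C ->
  (ndd (hplus (ximage A xi H) (ximage A xi H)) <= C)%N.
Proof.
move=> C0 [Y [E [Y0 dE shE]]]; apply/bigmax_leqP => h _.
apply: ndd_fibre_le => //; set X := hplus _ _.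
pose reps (x : GE) (ab : G * G) :=
  (ab.1 \in H) && (ab.2 \in H) /\ x = pairGE ab.
pose rep x := epsilon (inhabits (0, 0)) (reps x).
have repP x : fibre X h x -> reps x (rep x).
  case=> -[_ [_ [[a aH ->] [[b bH ->] Ex]]]] _; apply: epsilon_spec.
  by exists (a, b); split; rewrite //= aH.
exists Y, (fun x => E (rep x).1 (rep x).2); split=> //; split=> [x x' y Xx Xx' _|x].
  have [Hx Ex] := repP _ Xx; have [Hx' Ex'] := repP _ Xx'.
  have Ep : (rep x).1 + (rep x).2 = (rep x').1 + (rep x').2.
    by have := congr1 fst Ex; have := congr1 fst Ex'; rewrite /= Xx.2 Xx'.2 => <- <-.
  move=> yx yx'; rewrite Ex Ex'.
  case: (rep x) (rep x') Hx Hx' Ep yx yx' => [a b] [a' b'] Hx Hx' Ep yx yx'.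
  apply: gsim_pairGE => //; apply: (shE _ _ _ _ y) => //.
  by rewrite !scale1r.
by case/repP => /dE.
Qed.

End DensityDependence.

(** The cost of eliminating the retained vector: [C^d] for [d]-tuples, [2] for dropping singular
    ones. *)
Definition amplify d C := (2 * C ^ d)%N.

(** * Dense subsets with labelled differences and labelled sums *)

Section Refinement.
Variables (p d s : nat) (A : 'M['F_p]_d) (xi : 'rV['F_p]_d -> {mpoly 'F_p[d]}).
Local Notation G := 'rV['F_p]_d.
Hypotheses (ds : (2 * s + 15 <= d)%N) (p_prime : prime p) (p_gt2 : (2 < p)%N).
Hypotheses (A_sym : A^T = A) (detA : \det A != 0).
Variable H : {set G}.
Hypothesis xi_homog : forall h, h \in H -> xi h \is s.-homog.
Local Notation labelled := (labelled A xi).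
Local Notation n := #|{: G}|.

Lemma prelabelled_amplify (e : 'F_p) (R : rel G) C : (d * amplify d C <= p)%N ->
    (forall a b, R a b -> (a \in H) && (b \in H)) ->
  prelabelled A xi e R C -> labelled e R (amplify d C).
Proof.
move=> pC; apply: (prelabelled_labelled ds p_prime p_gt2 A_sym detA xi_homog).
by rewrite -mulnA mulnCA.
Qed.

Lemma popular_labelled (e : 'F_p) (H' : {set G}) k :
  e * e = 1 -> (d * amplify d k <= p)%N ->
  H' \subset H -> labelled e (popular A xi e H' k) (amplify d k).
Proof.
move=> ee pk /subsetP HH; apply: prelabelled_amplify => // [a b /popular_mem/andP[? ?]|].
  by rewrite !HH.
exact: popular_prelabelled.
Qed.

(** [C0] labels the popular differences [D]; [C1] labels [De], joined by many paths [a, v, b] with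
    the second edge reversed; [C2] labels pairs in [H'], joined by many paths of two [De]-edges.
    Each bound on [p] permits one amplification. *)
Lemma differences_labelled N (B := (2 * N)%N) (C0 := amplify d B)
    (C1 := amplify d (16 * B ^ 2 * C0 * C0)) (C2 := amplify d (4 * B * C1 * C1)) :
    (d * C0 <= p)%N -> (d * C1 <= p)%N -> (d * C2 <= p)%N ->
    (n ^ 3 <= N * #|quads A xi (-1)%R H|)%N ->
  exists H' : {set G}, [/\ H' \subset H, (n <= 4 * B * #|H'|)%N &
    labelled (-1) (fun a b => (a \in H') && (b \in H')) C2].
Proof.
move=> p0 p1 p2 /card_popular; rewrite -/B; set D := popular _ _ _ _ _ => DB.
have [|H' [nH' DH' H'De]] := dependent_random_choice _ DB; first exact: card_G_gt0.
pose De : rel G := fun a b => (n <= 16 * B ^ 2 * codeg D a b)%N.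
have mem_D a b : D a b -> (a \in H) && (b \in H) by apply: popular_mem.
have lab0 : labelled (-1) D C0.
  by apply: popular_labelled; rewrite ?mulrNN ?mulr1.
have HH' : H' \subset H by apply/subsetP => a /DH'[z /mem_D/andP[]].
have lab1 : labelled (-1) De C1.
  apply: prelabelled_amplify => // [a b|].
    rewrite /De /codeg => h; have : (0 < #|[set v | D a v & D b v]|)%N.
      by case: #|[set v | _]| h => //; rewrite muln0 leqNgt card_G_gt0.
    by case/card_gt0P => v; rewrite inE => /andP[/mem_D/andP[-> _] /mem_D/andP[->]].
  by apply: prelabelled_comp lab0 (labelled_flip lab0) _ => a b.
exists H'; split=> //; apply: prelabelled_amplify => // [a b /andP[aH bH]|].
  by rewrite !(subsetP HH').
by apply: (prelabelled_comp lab1 lab1) => a b /andP[]; apply: H'De.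
Qed.

(** Labelled differences give [H'] large energy, hence many popular sums. [H''] keeps the [b] with
    [u + b] popular for many [u], and [a + b = (a - u) + (u + b)] composes a labelled difference
    with a labelled sum. *)
Lemma sums_labelled K C (H' : {set G}) (M := (K ^ 4 * C ^ 2)%N)
    (C1 := amplify d (2 * M)) (C2 := amplify d (4 * M * C * C1)) :
    (d * C1 <= p)%N -> (d * C2 <= p)%N ->
    H' \subset H -> (n <= K * #|H'|)%N ->
    labelled (-1) (fun a b => (a \in H') && (b \in H')) C ->
  exists H'' : {set G}, [/\ H'' \subset H', (n <= 4 * M * #|H''|)%N &
    labelled 1 (fun a b => (a \in H'') && (b \in H'')) C2].
Proof.
move=> p1 p2 HH' nH' lab.
have n0 : (0 < n)%N by apply: card_G_gt0.
have nQ : (n ^ 3 <= M * #|quads A xi 1%R H'|)%N.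
  have q4 : (#|H'| ^ 4 <= C ^ 2 * n * #|quads A xi 1%R H'|)%N.
    apply: leq_trans (labelled_quads (H := H') lab _) _ => [a b -> -> //|].
    by rewrite leq_mul2l card_quads_diff_sum orbT.
  have h4 : (n ^ 4 <= K ^ 4 * #|H'| ^ 4)%N by rewrite -expnMn leq_exp2r.
  rewrite -(leq_pmul2r n0) -expnSr; apply: leq_trans h4 _.
  by apply: leq_trans (leq_mul (leqnn _) q4) _; rewrite /M; apply: eq_leq; lia.
have := card_popular nQ; set D := popular _ _ _ _ _ => DM.
have mem_D a b : D a b -> (a \in H') && (b \in H') by apply: popular_mem.
have lab1 : labelled 1 D C1 by apply: popular_labelled; rewrite ?mulr1.
pose f b := #|[set a | D a b]|.
have sumf : (n * n <= 2 * M * \sum_b f b)%N.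
  rewrite mulnn; apply: leq_trans DM _; rewrite leq_mul2l; apply/orP; right.
  pose S := [set x : G * G | D x.2 x.1].
  have -> : (\sum_b f b = #|S|)%N.
    by rewrite card_fibres; apply: eq_bigr => b _; apply: eq_card => a; rewrite !inE.
  apply: (@leq_card_in_inj _ _ (fun x : G * G => (x.2, x.1))).
    by move=> [a b] [a' b'] _ _ [-> ->].
  by move=> [a b]; rewrite !inE.
have eM : (2 * (2 * M) = 4 * M)%N by lia.
have := popularity (fun b => max_card _) n0 sumf; rewrite eM.
set H'' := [set b | _] => nH''; exists H''.
have H''P b : b \in H'' -> (b \in H') /\ (n <= 4 * M * f b)%N.
  rewrite inE => h; have {}h : (n <= 4 * M * f b)%N by exact: h.
  split=> //; have : (0 < f b)%N.
    by case: (f b) h => //; rewrite muln0 leqNgt n0.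
  by case/card_gt0P => a; rewrite inE => /mem_D/andP[].
have HH'' : H'' \subset H' by apply/subsetP => b /H''P[].
split=> //; apply: prelabelled_amplify => // [a b /andP[aH bH]|].
  by rewrite !(subsetP HH') ?(subsetP HH'').
apply: prelabelled_comp lab lab1 _ => a b /andP[/H''P[aH _] /H''P[_ hb]].
apply: leq_trans hb _; rewrite leq_mul2l subset_leq_card ?orbT //.
apply/subsetP => u; rewrite !inE => Du; rewrite aH Du.
by have /andP[->] := mem_D _ _ Du.
Qed.

End Refinement.

Theorem theorem5p9 :
  forall (d : nat), (0 < d)%N ->
  forall (delta : Rdefinitions.R), 0 < delta ->
  exists (p0 : nat) (c : Rdefinitions.R) (C : nat), 0 < c /\
  forall (s : nat), (2 * s + 15 <= d)%N ->
  forall (p : nat), prime p -> (p0 <= p)%N ->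
  forall (A : 'M['F_p]_d) (u : 'rV['F_p]_d) (v : 'F_p),
    A^T = A -> \det A != 0 ->
  forall (H : {set 'rV['F_p]_d}) (xi : 'rV['F_p]_d -> {mpoly 'F_p[d]}),
    (forall h, h \in H -> xi h \is s.-homog) ->
    delta * (p%:R ^+ (3 * d)) <= (Menergy A H xi)%:R ->
  exists H' : {set 'rV['F_p]_d},
    H' \subset H /\
    c * (p%:R ^+ d) <= (#|H'|)%:R /\
    (ndd (hplus (ximage A xi H') (ximage A xi H')) <= C)%N.
Proof.
move=> d d_gt0 delta delta_gt0.
(* As [N] exceeds [1 / delta], the cube of the size of the space is at most [N] times the energy. *)
pose N := (Num.truncn delta^-1).+1.
pose B := (2 * N)%N; pose C0 := amplify d B.
pose C1 := amplify d (16 * B ^ 2 * C0 * C0).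
pose C2 := amplify d (4 * B * C1 * C1).
(* [4 B] and [C2], the density loss and label constant for differences, act as [K] and [C] in
   [sums_labelled]. *)
pose M := ((4 * B) ^ 4 * C2 ^ 2)%N; pose C3 := amplify d (2 * M).
pose C4 := amplify d (4 * M * C2 * C3).
have mul0 a b : (0 < a -> 0 < b -> 0 < a * b)%N by rewrite muln_gt0 => -> ->.
have exp0 a m : (0 < a -> 0 < a ^ m)%N by rewrite expn_gt0 => ->.
have amp0 k : (0 < k -> 0 < amplify d k)%N by move=> k0; apply: mul0 (exp0 _ _ k0).
have B0 : (0 < B)%N by [].
have C00 : (0 < C0)%N := amp0 _ B0.
have C10 : (0 < C1)%N.
  by apply: amp0 (mul0 _ _ (mul0 _ _ (mul0 _ _ _ (exp0 _ _ B0)) C00) C00).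
have C20 : (0 < C2)%N by apply: amp0 (mul0 _ _ (mul0 _ _ (mul0 _ _ _ B0) C10) C10).
have M0 : (0 < M)%N by apply: mul0 (exp0 _ _ (mul0 _ _ _ B0)) (exp0 _ _ C20).
have C30 : (0 < C3)%N by apply: amp0 (mul0 _ _ _ M0).
have C40 : (0 < C4)%N by apply: amp0 (mul0 _ _ (mul0 _ _ (mul0 _ _ _ M0) C20) C30).
(* The threshold dominates [3], making [p] odd, and every [d * C_i] required for amplification. *)
exists (3 + d * C0 + d * C1 + d * C2 + d * C3 + d * C4)%N, (4 * M)%:R^-1, C4.
split; first by rewrite invr_gt0 ltr0n; apply: mul0.
move=> s ds p p_prime p_large A _ _ A_sym detA H xi xi_homog energy.
have cG : #|{: 'rV['F_p]_d}| = (p ^ d)%N by rewrite card_mx card_Fp ?mul1n.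
have p_gt2 : (2 < p)%N by lia.
have quadsN : (#|{: 'rV['F_p]_d}| ^ 3 <= N * #|quads A xi (-1)%R H|)%N.
  apply: leq_trans (leq_mul (leqnn N) (Menergy_le_quads A xi H)).
  rewrite cG -expnM [(d * 3)%N]mulnC -(ler_nat Rdefinitions.R) natrM natrX.
  have dN : delta^-1 <= N%:R.
    by apply/ltW/truncnS_gt.
  apply: le_trans (ler_wpM2l (ler0n _ N) energy).
  rewrite mulrA ler_peMl ?exprn_ge0 ?ler0n //.
  by rewrite -ler_pdivrMr // div1r.
have [||||H1 [H1H nH1 lab1]] := differences_labelled ds p_prime p_gt2 A_sym detA
  xi_homog (N := N); rewrite -/B -/C0 -/C1 -/C2 //; try lia.
have [||H2 [H2H1 nH2 lab2]] := sums_labelled ds p_prime p_gt2 A_sym detA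
  xi_homog _ _ H1H nH1 lab1; rewrite -/M -/C3 -/C4 //; try lia.
exists H2; split; first exact: subset_trans H2H1 H1H.
split; last exact: labelled_ndd.
rewrite ler_pdivrMl; last by rewrite ltr0n; apply: mul0.
by rewrite -natrX -natrM ler_nat -cG.
Qed.
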